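(* Let $\mathcal{X}$ be a finite-dimensional real vector space, $\mathcal{C}\subset\mathcal{X}$ a closed pointed convex cone with nonempty interior $\mathcal{C}^0$, $\mathbf{e}\in\mathcal{C}^0$, and let $L:\mathcal{X}\to\mathcal{X}$ be a linear map with $L(\mathbf{e})=0$. Then the optimal constant $\alpha$ (i.e. the infimum of all $\alpha\in\mathbb{R}$) such that $$\|\exp(tL)x\|_H\le e^{\alpha t}\|x\|_H\qquad\text{for all }t\ge0,\ x\in\mathcal{X}$$ is $$h(L):=-\inf_{\nu,\pi\in\operatorname{extr}\mathcal{P}(\mathbf{e})}\ \inf_{\substack{x\in\operatorname{extr}([0,\mathbf{e}])\\ \langle\nu,x\rangle+\langle\pi,\mathbf{e}-x\rangle=0}}\big(\langle\nu,L(x)\rangle+\langle\pi,L(\mathbf{e}-x)\rangle\big).$$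
   Context: Pointed: $\mathcal{C}\cap(-\mathcal{C})=\{0\}$. Order: $x\le y$ iff $y-x\in\mathcal{C}$; $[0,\mathbf{e}]=\{x:0\le x\le\mathbf{e}\}$. Hopf's oscillation seminorm: $\|x\|_H=\inf\{t\in\mathbb{R}:x\le t\mathbf{e}\}-\sup\{t\in\mathbb{R}:x\ge t\mathbf{e}\}$. Dual cone $\mathcal{C}^\star=\{\mu\in\mathcal{X}^\star:\langle\mu,x\rangle\ge0\ \forall x\in\mathcal{C}\}$; $\mathcal{P}(\mathbf{e})=\{\mu\in\mathcal{C}^\star:\langle\mu,\mathbf{e}\rangle=1\}$; $\operatorname{extr}$ denotes extreme points. Infima are taken in $[-\infty,+\infty]$ with $\inf\emptyset=+\infty$. *)

(* Defs.v *)
From HB Require Import structures.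
From mathcomp Require Import all_boot all_order all_algebra.
From mathcomp Require Import all_classical all_reals all_analysis.

Set Implicit Arguments.
Unset Strict Implicit.
Unset Printing Implicit Defensive.

Import Order.TTheory GRing.Theory Num.Theory.
Import numFieldNormedType.Exports.

Local Open Scope classical_set_scope.
Local Open Scope ring_scope.

Section ExtremePoints.
Context {R : realType} {V : lmodType R}.

Definition extr (A : set V) : set V :=
  [set x | A x /\ forall (y z : V) (t : R), A y -> A z -> 0 < t < 1 ->
     x = t *: y + (1 - t) *: z -> y = x /\ z = x].

End ExtremePoints.

Section Cones.
Context {R : realType} {X : normedModType R}.
Implicit Types (C : set X) (e x y : X).

Definition convex_cone C : Prop :=
  convex_set C /\ forall (t : R) x, 0 <= t -> C x -> C (t *: x).

Definition pointed C : Prop := C `&` [set - x | x in C] = [set 0].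

Definition cone_le C x y : Prop := C (y - x).

Definition order_segment C e : set X :=
  [set x | cone_le C 0 x /\ cone_le C x e].

(* Extended-real valued, so that no default value of a real infimum is
   involved. When e is interior to a closed pointed cone it is finite, except
   in the zero space, where it is constantly -oo. *)
Definition hopf_seminorm C e x : \bar R :=
  (ereal_inf [set t%:E | t in [set t : R | cone_le C x (t *: e)]]
   - ereal_sup [set t%:E | t in [set t : R | cone_le C (t *: e) x]])%E.

(* Functionals are plain functions, so that the dual sits inside the
   pointwise R-module X -> R^o, in which extreme points are taken. *)
Definition dual : set (X -> R^o) := [set mu | linear mu /\ continuous mu].

Definition dual_cone C : set (X -> R^o) :=
  [set mu | dual mu /\ forall x, C x -> 0 <= mu x].

(* $\mathcal{P}(\mathbf{e})$ *)
Definition cone_states C e : set (X -> R^o) :=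
  [set mu | dual_cone C mu /\ mu e = 1].

Definition exp_op (A : X -> X) x : X :=
  limn (series (fun k : nat => (k`!%:R : R)^-1 *: iter k A x)).

Definition optimal_rate C e (L : X -> X) : \bar R :=
  ereal_inf [set alpha%:E | alpha in [set alpha : R |
    forall (t : R) x, 0 <= t ->
      (hopf_seminorm C e (exp_op (fun y => t *: L y) x)
       <= (expR (alpha * t))%:E * hopf_seminorm C e x)%E]].

(* $-\inf_{\nu,\pi}\inf_x(\dots)$; the infimum over an empty family is +oo. *)
Definition contraction_formula C e (L : X -> X) : \bar R :=
  (- ereal_inf
      [set ereal_inf
         [set (nupi.1 (L x) + nupi.2 (L (e - x)))%R%:E
           | x in [set x | extr (order_segment C e) x
                           /\ (nupi.1 x + nupi.2 (e - x) = 0)%R]]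
       | nupi in extr (cone_states C e) `*` extr (cone_states C e)])%E.

End Cones.

(* Main.v *)
From HB Require Import structures.
Require Import Defs.
From mathcomp Require Import all_boot all_order all_algebra.
From mathcomp Require Import all_classical all_reals all_analysis.
From mathcomp Require Import ring lra.
Import Order.TTheory GRing.Theory Num.Theory.
Import numFieldNormedType.Exports.
Local Open Scope classical_set_scope.
Local Open Scope ring_scope.

(** Let e be nonzero, and write p(x) for the least t with x <= t e. This gauge
    is sublinear, the states are exactly the linear functionals below it, and
    Hopf's seminorm of x is p(x) + p(-x), that is, the maximum of
    pi(x) - nu(x) over pairs of states, attained at extreme states
    (ex_extreme_state).

    Lower bound for the rate. Let nu, pi be states and x a point of the order
    segment with nu(x) = 0 and pi(x) = 1. Its oscillation is 1, so a decay
    estimate with rate a gives (pi - nu)(exp(tL) x) <= exp(a t), with equality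
    at t = 0. Differentiating at 0 from the right yields (pi - nu)(L x) <= a,
    which is the inequality in the formula because L e = 0
    (decay_extremal_bound).

    Upper bound. Suppose (pi - nu)(L x) <= a for all the extreme data of the
    formula. For an arbitrary y choose extreme states pi and nu maximal and
    minimal at y. If the oscillation of y vanishes, then y is a multiple of e
    and L y = 0. Otherwise, after subtracting nu(y) e and dividing by the
    oscillation, y becomes a point of the order segment on the face where
    pi = 1 and nu = 0. On this compact face the functional (pi - nu) L is
    maximal at a point that is extreme in the whole segment, so
    (pi - nu)(L y) <= a osc(y)
    (extremal_pair_le). Along y(t) = exp(tL) x the function osc(y(t)) is thus
    touched from below, at each time, by a differentiable function
    (pi - nu)(y(t)) whose derivative is at most a osc(y(t)); a maximum principle
    turns this into osc(y(t)) <= exp(a t) osc(x) (gronwall_touching,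
    oscillation_decay).

    Extreme points are produced by lexicographic optimisation. For the states
    it is carried out on support functions: replacing a sublinear p by
    tighten p y passes to the face of the functionals maximal at y, and after
    finitely many steps only one linear functional is left
    (ex_extreme_support). For the order segment, which is compact in
    coordinates, the maximum over a compact set is refined by the successive
    coordinates until it is a single point (ex_extreme_lexmax).

    The degenerate case e = 0 forces X = 0, and both sides are -oo
    (zero_unit_rate). *)

(** Functionals of the dual are bare functions; this gives access to the
    algebraic rewriting rules for them. *)
Lemma linear_bundle {R : realType} {U V : lmodType R} (h : U -> V) :
  linear h -> exists k : {linear U -> V}, h = k.
Proof.
move=> lh.
pose k : {linear U -> V} :=
  HB.pack h (GRing.isLinear.Build R U V *:%R h lh).
by exists k.
Qed.

Lemma vector_axiom_coordinates {R : realType} {V : lmodType R} {n : nat} :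
  Vector.axiom n V ->
  exists (f : {linear V -> 'rV[R]_n}) (g : {linear 'rV[R]_n -> V}),
    cancel f g /\ cancel g f.
Proof.
move=> [f lf [g fK gK]].
have lg : linear g by move=> a u v; apply: (can_inj fK); rewrite gK lf !gK.
have [f' fE] := linear_bundle f lf; have [g' gE] := linear_bundle g lg.
by exists f', g'; rewrite -fE -gE.
Qed.

(** * Sublinear functionals and extreme linear minorants *)

Section SublinearFunctionals.
Context {R : realType} {V : lmodType R}.
Implicit Types (p q : V -> R) (x y : V).

Definition sublinear p : Prop :=
  (forall x y, p (x + y) <= p x + p y) /\
  (forall (a : R) x, 0 <= a -> p (a *: x) = a * p x).

Lemma sublinear0 {p} : sublinear p -> p 0 = 0.
Proof. by case=> _ /(_ 0 0 (lexx _)); rewrite scale0r mul0r. Qed.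

Lemma sublinear_ge_opp {p} x : sublinear p -> - p (- x) <= p x.
Proof.
move=> sp; have := sp.1 x (- x); rewrite subrr (sublinear0 sp) => *; lra.
Qed.

(** When p is the support function of a convex set of functionals, this is the
    support function of the face on which evaluation at y is maximal. *)
Definition tighten p y x : R :=
  inf [set p (x + s *: y) - s * p y | s in [set s : R | 0 <= s]].

Lemma tighten_glb p y x (c : R) :
  (forall s, 0 <= s -> c <= p (x + s *: y) - s * p y) -> c <= tighten p y x.
Proof.
move=> h; apply: lb_le_inf.
  by exists (p (x + 0 *: y) - 0 * p y); exists 0 => //=.
by move=> _ [s s0 <-]; exact: h.
Qed.

Lemma tighten_lb p y x (s : R) :
  sublinear p -> 0 <= s -> tighten p y x <= p (x + s *: y) - s * p y.
Proof.
move=> sp s0; apply: ge_inf; last by exists s.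
exists (- p (- x)) => _ [r r0 <-].
have := sp.1 (x + r *: y) (- x).
rewrite addrAC subrr add0r (sp.2 r y r0) => *; lra.
Qed.

Lemma tighten_le p y x : sublinear p -> tighten p y x <= p x.
Proof.
move=> sp; have := tighten_lb p y x 0 sp (lexx _).
by rewrite scale0r mul0r addr0 subr0.
Qed.

Lemma tighten_oppr p y : sublinear p -> tighten p y (- y) <= - p y.
Proof.
move=> sp; have := tighten_lb p y (- y) 1 sp ler01.
by rewrite scale1r mul1r addNr (sublinear0 sp) sub0r.
Qed.

Lemma sublinear_tighten p y : sublinear p -> sublinear (tighten p y).
Proof.
move=> sp; split=> [x1 x2|].
  rewrite -lerBlDr; apply: tighten_glb => s s0.
  rewrite lerBlDr -lerBlDl; apply: tighten_glb => r r0.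
  have := tighten_lb p y (x1 + x2) (s + r) sp (addr_ge0 s0 r0).
  have := sp.1 (x1 + s *: y) (x2 + r *: y).
  rewrite addrACA -scalerDl mulrDl => *; lra.
have hle (a : R) x : 0 < a -> tighten p y (a *: x) <= a * tighten p y x.
  move=> a0; rewrite -ler_pdivrMl//; apply: tighten_glb => s s0.
  rewrite ler_pdivrMl//.
  have := tighten_lb p y (a *: x) (a * s) sp (mulr_ge0 (ltW a0) s0).
  by rewrite -scalerA -scalerDr (sp.2 a _ (ltW a0)) -mulrA -mulrBr.
move=> a x; rewrite le_eqVlt => /predU1P[<-|a0].
  rewrite scale0r mul0r; apply/eqP; rewrite eq_le; apply/andP; split.
    by rewrite -[leRHS](sublinear0 sp) tighten_le.
  by apply: tighten_glb => s s0; rewrite add0r sp.2// subrr.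
apply/eqP; rewrite eq_le hle//=.
have := hle a^-1 (a *: x); rewrite invr_gt0 => /(_ a0).
by rewrite scalerA mulVf ?gt_eqF// scale1r ler_pdivlMl.
Qed.

Lemma le_tighten p y (mu : V -> R^o) : linear mu -> (forall x, mu x <= p x) ->
  mu y = p y -> forall x, mu x <= tighten p y x.
Proof.
move=> lmu mup muy x; apply: tighten_glb => s s0.
have := mup (x + s *: y); rewrite [x + _]addrC lmu muy /=.
by rewrite [_ *: _]/(s * p y) -lerBrDl.
Qed.

(** Tightening successively at each vector of ys yields the support function
    of a lexicographically extremal face: functionals of which a proper convex
    combination reaches it must already lie in that face. *)
Lemma sublinear_face p (ys : seq V) : sublinear p ->
  exists q : V -> R, [/\ sublinear q, forall x, q x <= p x,
    {in ys, forall y, q (- y) = - q y},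
    (forall y, ohead ys = Some y -> q y = p y) &
    forall (mu1 mu2 : V -> R^o) (t : R), linear mu1 -> linear mu2 ->
      (forall x, mu1 x <= p x) -> (forall x, mu2 x <= p x) -> 0 < t < 1 ->
      (forall x, q x = t * mu1 x + (1 - t) * mu2 x) ->
      (forall x, mu1 x <= q x) /\ (forall x, mu2 x <= q x)].
Proof.
elim: ys p => [|y ys IH] p sp.
  by exists p; split.
have [q [sq qp qN _ qE]] := IH _ (sublinear_tighten p y sp).
have qle x : q x <= p x by rewrite (le_trans (qp x))// tighten_le.
have qNy : q (- y) <= - p y by rewrite (le_trans (qp _))// tighten_oppr.
have qy : q y = p y.
  apply/eqP; rewrite eq_le qle /=; have := sublinear_ge_opp y sq => *; lra.
exists q; split=> //.
- move=> x; rewrite inE => /predU1P[->|]; last exact: qN.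
  have := sublinear_ge_opp y sq; move: qNy; rewrite qy => h1 h2; lra.
- by move=> _ [<-].
- move=> m1 m2 t l1 l2 h1 h2 t01 qt.
  (* both functionals attain p y, as their proper convex combination does *)
  have := qt y; rewrite qy => ty.
  have e1 : m1 y = p y.
    by apply/eqP; rewrite eq_le h1 /=; have := h2 y; have := h1 y => *; nra.
  have e2 : m2 y = p y.
    by apply/eqP; rewrite eq_le h2 /=; have := h2 y; have := h1 y => *; nra.
  by apply: (qE m1 m2 t) => //; exact: le_tighten.
Qed.

(** Subadditivity at x, y and at - x, - y gives the two inequalities of
    additivity; oddness carries homogeneity over to negative scalars. *)
Lemma sublinear_odd_linear q : sublinear q -> (forall x, q (- x) = - q x) ->
  linear (q : V -> R^o).
Proof.
move=> sq qN.
have qD x y : q (x + y) = q x + q y.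
  apply/eqP; rewrite eq_le sq.1 /=.
  by have := sq.1 (- x) (- y); rewrite -opprD !qN => *; lra.
have qZ (a : R) x : q (a *: x) = a * q x.
  have [a0|a0] := leP 0 a; first exact: sq.2.
  have := sq.2 (- a) (- x); rewrite oppr_ge0 (ltW a0) => /(_ isT).
  by rewrite scaleNr scalerN opprK qN mulrNN.
by move=> a x y; rewrite qD qZ.
Qed.

Lemma sublinear_odd_span q n (b : 'I_n -> V) (c : 'I_n -> R) : sublinear q ->
  (forall i, q (- b i) = - q (b i)) ->
  q (- \sum_i c i *: b i) = - q (\sum_i c i *: b i).
Proof.
move=> sq qb; elim/big_ind : _ => [|x y hx hy|i _].
- by rewrite oppr0 (sublinear0 sq) oppr0.
- have := sq.1 x y; have := sq.1 (- x) (- y).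
  have := sublinear_ge_opp (x + y) sq; rewrite opprD hx hy.
  by move=> h1 h2 h3; apply/eqP; rewrite eq_le; apply/andP; split; lra.
- have [c0|/ltW c0] := leP 0 (c i).
    by rewrite -scalerN !sq.2// qb mulrN.
  have c1 : 0 <= - c i by rewrite oppr_ge0.
  have -> : c i *: b i = (- c i) *: (- b i) by rewrite scaleNr scalerN opprK.
  by rewrite -scalerN opprK !sq.2// qb mulrN opprK.
Qed.

(** Tightening at y and then at a spanning family leaves a sublinear functional
    that is odd, hence linear. It attains p at y because y comes first, and it
    is extreme because two linear functionals one below the other agree. This
    is Hahn-Banach and the existence of extreme points of a face of the dual
    base in one stroke. *)
Lemma ex_extreme_support p n (b : 'I_n -> V) (c : V -> 'I_n -> R) (y : V) :
    (forall x, x = \sum_i c x i *: b i) -> sublinear p ->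
  exists mu : V -> R^o, [/\ linear mu, forall x, mu x <= p x, mu y = p y &
    forall (mu1 mu2 : V -> R^o) (t : R), linear mu1 -> linear mu2 ->
      (forall x, mu1 x <= p x) -> (forall x, mu2 x <= p x) -> 0 < t < 1 ->
      mu = t *: mu1 + (1 - t) *: mu2 -> mu1 = mu /\ mu2 = mu].
Proof.
move=> xE sp.
have [q [sq qp qN qy qE]] := sublinear_face p (y :: codom b) sp.
have qodd x : q (- x) = - q x.
  rewrite (xE x); apply: sublinear_odd_span => // i.
  by apply: qN; rewrite inE codom_f orbT.
have lq := sublinear_odd_linear q sq qodd.
exists q; split=> //; first exact: qy.
move=> m1 m2 t l1 l2 h1 h2 t01 qt.
have [//|k1 k2] := qE m1 m2 t l1 l2 h1 h2 t01 _.
  by move=> x; rewrite qt.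
(* two linear functionals, one below the other, coincide *)
have eqq (m : V -> R^o) : linear m -> (forall x, m x <= q x) -> m = q.
  move=> lm mq; apply/funext => x; apply/eqP; rewrite eq_le mq /=.
  have m0 : m 0 = 0.
    by have := lm (-1) 0 0; rewrite scaler0 addr0 scaleN1r addNr.
  have mN : m (- x) = - m x.
    by have := lm (-1) x 0; rewrite addr0 m0 addr0 !scaleN1r.
  by have := mq (- x); rewrite mN qodd lerN2.
by split; exact: eqq.
Qed.

End SublinearFunctionals.

(** * Seminorms and compact sets of row vectors *)

Section Seminorms.
Context {R : realType} {V : lmodType R}.
Implicit Types (q : V -> R).

Definition seminorm (q : V -> R) : Prop :=
  (forall x y, q (x + y) <= q x + q y) /\ (forall a x, q (a *: x) = `|a| * q x).

Lemma seminorm0 (q : V -> R) : seminorm q -> q 0 = 0.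
Proof. by case=> _ /(_ 0 0); rewrite scale0r normr0 mul0r. Qed.

Lemma seminorm_ge0 (q : V -> R) x : seminorm q -> 0 <= q x.
Proof.
move=> sq; have := sq.1 x (-1 *: x).
by rewrite sq.2 normrN1 mul1r scaleN1r subrr (seminorm0 _ sq) => ?; lra.
Qed.

Lemma seminorm_sum (q : V -> R) m (x : 'I_m -> V) :
  seminorm q -> q (\sum_i x i) <= \sum_i q (x i).
Proof.
move=> sq; elim/big_ind2 : _ => // [|a b c d h1 h2].
  by rewrite (seminorm0 _ sq).
by rewrite (le_trans (sq.1 _ _))// lerD.
Qed.

End Seminorms.

Section RowVectors.
Context {R : realType} {n : nat}.
Implicit Types (v w : 'rV[R]_n) (K : set 'rV[R]_n).

Lemma ler_coord_norm v j : `|v 0 j| <= `|v|.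
Proof.
rewrite [leRHS]/Num.norm /= mx_normrE.
exact: (le_bigmax _ (fun ij => `|v ij.1 ij.2|) (0, j)).
Qed.

Lemma seminorm_le_norm (q : 'rV[R]_n -> R) v : seminorm q ->
  q v <= (\sum_j q 'e_j) * `|v|.
Proof.
move=> sq; rewrite {1}(row_sum_delta v).
rewrite (le_trans (seminorm_sum _ _ _ sq))// mulr_suml; apply: ler_sum => j _.
by rewrite sq.2 mulrC ler_wpM2l ?seminorm_ge0// ler_coord_norm.
Qed.

Lemma seminorm_continuous (q : 'rV[R]_n -> R) : seminorm q -> continuous q.
Proof.
move=> sq v; apply/(@cvgrPdist_lt _ _ _ (nbhs v) (nbhs_filter v)) => eps eps0.
pose M := \sum_j q 'e_j + 1.
have M0 : 0 < M by rewrite ltr_wpDl// sumr_ge0// => j _; exact: seminorm_ge0.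
near=> w.
have qb u : q u <= M * `|u|.
  by rewrite (le_trans (seminorm_le_norm q u sq))// ler_wpM2r// lerDl.
have h1 := sq.1 (v - w) w; have h2 := sq.1 (w - v) v.
have hvw := qb (v - w); have := qb (w - v); rewrite distrC => hwv.
rewrite !subrK in h1 h2.
apply: (@le_lt_trans _ _ (M * `|v - w|)).
  by rewrite ler_norml; apply/andP; split; lra.
rewrite -ltr_pdivlMl// mulrC; near: w.
apply/nbhs_ballP; exists (eps / M) => /=; first exact: divr_gt0.
by move=> w; rewrite -ball_normE.
Unshelve. all: by end_near. Qed.

(** A seminorm vanishing only at 0 dominates the norm: it is bounded away from
    0 on the compact unit sphere. *)
Lemma norm_le_seminorm (q : 'rV[R]_n -> R) : seminorm q ->
  (forall v, q v = 0 -> v = 0) -> exists M : R, forall v, `|v| <= M * q v.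
Proof.
move=> sq q0; pose S := [set v : 'rV[R]_n | `|v| = 1].
have cS : compact S.
  apply: bounded_closed_compact.
    by exists 1; split=> // x x1 v /= ->; exact: ltW.
  apply: (closed_comp (f := fun v : 'rV[R]_n => `|v|)
    (D := [set x : R | x = 1])); last exact: closed_eq.
  by move=> v _; exact: norm_continuous.
have unitS v : v != 0 -> S (`|v|^-1 *: v).
  by move=> v0; rewrite /S /= normrZ normfV normr_id mulVf ?normr_eq0.
have [S0|/set0P/negP/negPn/eqP S0] := pselect (S !=set0); last first.
  exists 0 => v; rewrite mul0r normr_le0; apply/negPn/negP => /unitS.
  by rewrite S0.
have [c cS1 cmin] := EVT_min_rV S0 cS
  (continuous_subspaceT (seminorm_continuous q sq)).
rewrite inE /S /= in cS1.
have qc : 0 < q c.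
  rewrite lt_neqAle seminorm_ge0// andbT eq_sym; apply/eqP => /q0 c0.
  by move: cS1; rewrite c0 normr0 => /esym/eqP; rewrite oner_eq0.
exists (q c)^-1 => v; have [->|v0] := eqVneq v 0.
  by rewrite normr0 (seminorm0 _ sq) mulr0.
rewrite ler_pdivlMl// mulrC.
have := cmin (`|v|^-1 *: v); rewrite inE => /(_ (unitS v v0)).
by rewrite sq.2 normfV normr_id ler_pdivlMl// normr_gt0.
Qed.

Lemma linear_continuous_rV {V : normedModType R} (f : {linear 'rV[R]_n -> V}) :
  continuous f.
Proof.
apply/linear_bounded_continuous/linear_boundedP.
have sf : seminorm (fun v => `|f v|).
  by split=> [x y|a x]; rewrite ?linearD ?linearZ ?ler_normD ?normrZ.
near=> r => v; apply: le_trans (seminorm_le_norm _ v sf) _.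
by rewrite ler_wpM2r//; near: r; exact: nbhs_pinfty_ge.
Unshelve. all: by end_near. Qed.

Lemma cvg_rV {T : Type} (F : set_system T) {FF : Filter F}
    (s : T -> 'rV[R]_n) v :
  (forall j, s t 0 j @[t --> F] --> v 0 j) -> s t @[t --> F] --> v.
Proof.
move=> h; rewrite (row_sum_delta v).
rewrite (_ : s = fun t => \sum_(j < n) s t 0 j *: 'e_j); last first.
  by apply/funext => t; exact: row_sum_delta.
apply: cvg_big => [|j _]; first exact: add_continuous.
by apply: cvgZr_tmp; exact: h.
Qed.

(** The maximisers over K for the lexicographic order on the values of fs,
    found one functional at a time so that compactness passes to each stage. *)
Fixpoint lexmax (fs : seq {linear 'rV[R]_n -> R^o}) K v : Prop :=
  if fs is f :: fs'
  then lexmax fs' [set u | K u /\ forall w, K w -> f w <= f u] v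
  else K v.

Lemma lexmax_sub fs K v : lexmax fs K v -> K v.
Proof. by elim: fs K => //= f fs IH K /IH[]. Qed.

Lemma lexmax_ex fs K : compact K -> K !=set0 -> exists v, lexmax fs K v.
Proof.
elim: fs K => [|f fs IH] K cK K0; first by case: K0 => v; exists v.
have [c cK1 cmax] := EVT_max_rV K0 cK
  (continuous_subspaceT (linear_continuous_rV f)).
rewrite inE in cK1; have {}cmax w : K w -> f w <= f c.
  by move=> Kw; apply: cmax; rewrite inE.
apply: IH; last by exists c.
rewrite (_ : mkset _ = K `&` [set u | f c <= f u]).
  apply: compact_closedI => //.
  apply: (closed_comp (f := f) (D := [set x : R | f c <= x]));
    last exact: closed_ge.
  by move=> u _; exact: linear_continuous_rV.
apply/seteqP; split=> u [Ku h]; split=> //; first exact: h.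
by move=> w /cmax /le_trans; apply.
Qed.

(** At each stage the current functional is maximal at a proper convex
    combination, which forces it to be maximal at both endpoints. *)
Lemma lexmax_extremal fs K v y z (t : R) : lexmax fs K v -> K y -> K z ->
  0 < t < 1 -> v = t *: y + (1 - t) *: z -> lexmax fs K y /\ lexmax fs K z.
Proof.
elim: fs K => [|f fs IH] K //= hv Ky Kz t01 vE.
have [Kv vmax] := lexmax_sub _ _ _ hv.
have fv : f v = t * f y + (1 - t) * f z by rewrite vE linearD !linearZ.
have [hy hz] := (vmax _ Ky, vmax _ Kz).
have [ey ez] : f y = f v /\ f z = f v by split; nra.
by apply: IH => //; split=> //; rewrite ?ey ?ez.
Qed.

Lemma lexmax_eq fs K v w : lexmax fs K v -> lexmax fs K w ->
  List.Forall (fun f : {linear 'rV[R]_n -> R^o} => f v = f w) fs.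
Proof.
elim: fs K => [|f fs IH] K /=; first by constructor.
move=> hv hw; constructor; last exact: IH hv hw.
have [Kv vmax] := lexmax_sub _ _ _ hv; have [Kw wmax] := lexmax_sub _ _ _ hw.
by apply/eqP; rewrite eq_le vmax// wmax.
Qed.

Lemma ex_coord_linear (j : 'I_n) :
  exists f : {linear 'rV[R]_n -> R^o}, forall v, f v = v 0 j.
Proof.
have [|f fE] := linear_bundle (fun v : 'rV[R]_n => v 0 j : R^o).
  by move=> a x y; rewrite !mxE.
by exists f => v; rewrite -fE.
Qed.

(** Continuing the lexicographic maximisation of f and g with all coordinates
    leaves a single point, which is extreme. *)
Lemma ex_extreme_lexmax K (f g : {linear 'rV[R]_n -> R^o}) :
  compact K -> K !=set0 ->
  exists v, [/\ extr K v, forall w, K w -> f w <= f v &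
    forall w, K w -> f w = f v -> g w <= g v].
Proof.
move=> cK K0; have [cs csE] := choice ex_coord_linear.
pose fs := f :: g :: [seq cs j | j <- enum 'I_n].
have [v vP] := lexmax_ex fs K cK K0; exists v.
have eqv w : lexmax fs K w -> w = v.
  move=> wP; apply/rowP => j; have := lexmax_eq fs K _ _ wP vP.
  move=> /List.Forall_forall /(_ (cs j)); rewrite !csE; apply.
  do 2 right; apply: List.in_map.
  have := mem_enum 'I_n j; elim: (enum _) => //= a l IH.
  by rewrite inE => /predU1P[->|/IH]; [left|right].
have [[Kv fmax] gmax] : lexmax [:: f; g] K v.
  by have := vP; rewrite /fs /= => /lexmax_sub.
split=> //.
  split=> // y z t Ky Kz t01 vE.
  by have [/eqv-> /eqv->] := lexmax_extremal fs K v y z t vP Ky Kz t01 vE.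
by move=> w Kw fw; apply: gmax; split=> // u /fmax; rewrite fw.
Qed.

End RowVectors.

(** * A differential inequality without differentiability *)

Section OneSidedDerivatives.
Context {R : realType}.
Implicit Types (f g : R -> R) (a c d s x T : R).

(** Testing the sign of difference quotients along any filter of nonzero
    increments covers the derivatives from the right and from the left. *)
Lemma is_derive_ge0 f x d (F : set_system R) {FF : ProperFilter F} :
  is_derive x (1 : R) f d -> F --> 0^' ->
  (\forall h \near F, 0 <= h^-1 * (f (x + h) - f x)) -> 0 <= d.
Proof.
move=> [df <-] F0 fle.
have hq : h^-1 *: ((f \o shift x) h%:A - f x) @[h --> F] --> 'D_1 f x.
  by apply: cvg_trans df; exact: cvg_app.
apply: (cvgr_to_ge hq); apply: filterS fle => h.
by rewrite /= [h%:A]mulr1 [x + h]addrC.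
Qed.

Lemma at_right_dnbhs0 : (0 : R)^'+ --> (0 : R)^'.
Proof. by apply: within_subset => h /= h0; rewrite gt_eqF. Qed.

Lemma at_left_dnbhs0 : (0 : R)^'- --> (0 : R)^'.
Proof. by apply: within_subset => h /= h0; rewrite lt_eqF. Qed.

(** A Gronwall inequality for functions that need not be differentiable: it is
    enough that at each positive time the function is touched from below by a
    differentiable one satisfying the differential inequality there. After
    discounting by the exponential and a linear drift eps * s, a maximum on
    [0, T] at a positive time would give the touching function a negative
    derivative at a maximum from the left. *)
Lemma gronwall_touching (G : R -> R) a T : continuous G -> 0 <= T ->
  (forall c, 0 < c -> exists (phi : R -> R) (d : R),
    [/\ is_derive c (1 : R) phi d, phi c = G c, forall s, phi s <= G s &
        d <= a * G c]) ->
  G T <= expR (a * T) * G 0.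
Proof.
move=> cG T0 touch.
suff decay eps : 0 < eps -> expR (- a * T) * G T - eps * T <= G 0.
  rewrite -ler_pdivrMl ?expR_gt0// -expRN -mulNr.
  have [->|Tn0] := eqVneq T 0; first by rewrite mulr0 expR0 mul1r.
  have Tp : 0 < T by rewrite lt_neqAle eq_sym Tn0.
  apply/ler_addgt0Pr => eps eps0; rewrite -lerBlDr.
  by have := decay (eps / T); rewrite divr_gt0// divfK//; exact.
move=> eps0.
pose D (u : R -> R) s := expR (- a * s) * u s - eps * s.
have cD : continuous (D G).
  move=> s; apply: cvgB.
    apply: cvgM; last exact: cG.
    apply: (continuous_comp (f := fun s => - a * s));
      last exact: continuous_expR.
    by apply: cvgM; [exact: cvg_cst|exact: cvg_id].
  by apply: cvgM; [exact: cvg_cst|exact: cvg_id].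
have [c cT cmax] := EVT_max T0 (continuous_subspaceT cD).
have DT : D G T <= D G c by apply: cmax; rewrite in_itv /= T0 lexx.
move: cT; rewrite in_itv /= => /andP[c0 cT].
have [c_eq0|cn0] := eqVneq c 0.
  by move: DT; rewrite c_eq0 /D !mulr0 expR0 mul1r subr0.
have cp : 0 < c by rewrite lt_neqAle eq_sym cn0.
have [phi [d [dphi phic phiG da]]] := touch c cp.
have dD : is_derive c (1 : R) (D phi) (expR (- a * c) * (d - a * G c) - eps).
  apply: is_derive_eq.
  by rewrite phic /GRing.scale /=; ring.
suff : 0 <= expR (- a * c) * (d - a * G c) - eps.
  have : expR (- a * c) * (d - a * G c) <= 0.
    by rewrite pmulr_rle0 ?expR_gt0// subr_le0.
  by move=> ? ?; lra.
apply: (is_derive_ge0 _ _ _ 0^'- dD at_left_dnbhs0).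
near=> h.
have h0 : h < 0 by near: h; exact: nbhs_left_lt.
rewrite nmulr_rge0 ?invr_lt0// subr_le0.
have -> : D phi c = D G c by rewrite /D phic.
have h1 : - c < h by near: h; apply: nbhs_left_gt; rewrite oppr_lt0.
apply: (@le_trans _ _ (D G (c + h))).
  by rewrite /D lerB// ler_wpM2l// expR_ge0.
by apply: cmax; rewrite in_itv /=; apply/andP; split; lra.
Unshelve. all: by end_near. Qed.

End OneSidedDerivatives.

(** * The exponential of an endomorphism, seen through linear functionals *)

Section OperatorExponential.
Context {R : realType} {X : normedModType R} {n : nat}.
Context (f : {linear X -> 'rV[R]_n}) (g : {linear 'rV[R]_n -> X}).
Hypotheses (fK : cancel f g) (gK : cancel g f).
Context (L : {linear X -> X}).
Implicit Types (h : {linear X -> R^o}) (x : X) (t : R).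

Definition exp_flow t x : X := exp_op (fun y => t *: L y) x.

(** In coordinates L is bounded, so iterates grow at most geometrically. *)
Lemma orbit_bound h x : exists B M : R,
  [/\ 0 <= B, 0 <= M & forall k, `|h (iter k L x)| <= B * M ^+ k].
Proof.
have sL : seminorm (fun v => `|f (L (g v))|).
  by split=> [y z|a y]; rewrite ?linearD ?linearZ ?ler_normD ?normrZ.
have sh : seminorm (fun v => `|h (g v)|).
  by split=> [y z|a y]; rewrite ?linearD ?linearZ ?ler_normD ?normrZ.
pose M := \sum_j `|f (L (g 'e_j))|; pose B := \sum_j `|h (g 'e_j)|.
have M0 : 0 <= M by exact: sumr_ge0.
have B0 : 0 <= B by exact: sumr_ge0.
exists (B * `|f x|), M; split=> //; first exact: mulr_ge0.
have hB y : `|h y| <= B * `|f y|.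
  by rewrite -{1}(fK y); exact: seminorm_le_norm sh.
have LM y : `|f (L y)| <= M * `|f y|.
  by rewrite -{1}(fK y); exact: seminorm_le_norm sL.
move=> k; rewrite (le_trans (hB _))// -mulrA ler_wpM2l//.
elim: k => [|k IH] /=; first by rewrite expr0 mulr1.
by rewrite (le_trans (LM _))// exprS mulrCA ler_wpM2l.
Qed.

Definition exp_coef h x : R^nat := fun k => h (iter k L x) / k`!%:R.

Lemma is_cvg_exp_coef h x t : cvgn (pseries (exp_coef h x) t).
Proof.
have [B [M [B0 M0 hB]]] := orbit_bound h x.
apply: normed_cvg.
have cE : cvgn (series (fun k => B * exp_coeff (M * `|t|) k)).
  by apply: is_cvg_seriesZ; exact: is_cvg_series_exp_coeff.
apply: series_le_cvg cE => k //=.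
  by rewrite /exp_coeff /= mulr_ge0// divr_ge0// exprn_ge0// mulr_ge0.
rewrite /exp_coef /exp_coeff /= !normrM normrX normfV (ger0_norm (ler0n _ _)).
rewrite exprMn mulrA mulrAC.
by rewrite ler_wpM2r ?invr_ge0// mulrA ler_wpM2r// exprn_ge0.
Qed.

(** Differentiating the power series of h amounts to replacing h by its
    composite with L. *)
Lemma pseries_diffs_exp_coef h x :
  pseries_diffs (exp_coef h x) = exp_coef (h \o L) x.
Proof.
apply/funext => k; rewrite /pseries_diffs /exp_coef /=.
rewrite factS natrM invfM mulrCA; congr (_ * _).
by rewrite mulrA mulfV ?mul1r// pnatr_eq0.
Qed.

(** A linear functional turns the exponential series into a real power series
    in t: convergence in X reduces to that of finitely many coordinates, and
    termwise differentiation becomes available. *)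
Lemma exp_flowE h x t : h (exp_flow t x) = limn (pseries (exp_coef h x) t).
Proof.
have iterE k : iter k (fun y => t *: L y) x = t ^+ k *: iter k L x.
  elim: k => [|k IH] /=; first by rewrite scale1r.
  by rewrite IH linearZ scalerA exprS.
pose s := series (fun k => (k`!%:R : R)^-1 *: iter k (fun y => t *: L y) x).
have sE (h' : {linear X -> R^o}) m : h' (s m) = pseries (exp_coef h' x) t m.
  rewrite /s /pseries /series /= linear_sum; apply: eq_bigr => k _.
  rewrite iterE !linearZ /exp_coef /=.
  by transitivity (k`!%:R^-1 * (t ^+ k * h' (iter k L x))); last ring.
have [cs csE] := choice (@ex_coord_linear R n).
pose w := \row_j limn (pseries (exp_coef (cs j \o f) x) t).
have fs : f (s m) @[m --> \oo] --> w.
  apply: cvg_rV => j; rewrite mxE.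
  under eq_fun do rewrite -csE.
  rewrite (_ : (fun m => _) = pseries (exp_coef (cs j \o f) x) t).
    exact: is_cvg_exp_coef.
  by apply/funext => m; exact: (sE (cs j \o f)).
have sw : s m @[m --> \oo] --> g w.
  under eq_fun do rewrite -[s _]fK.
  by apply: continuous_cvg => //; exact: linear_continuous_rV.
rewrite /exp_flow /exp_op -/s (cvg_lim _ sw)//.
have hw : h (s m) @[m --> \oo] --> h (g w).
  under eq_fun do rewrite -[s _]fK.
  have c := continuous_cvg _ (linear_continuous_rV (h \o g) w) fs.
  exact: (c eventually_filter).
by rewrite -(cvg_lim _ hw)//; congr (limn _); apply/funext => m; exact: sE.
Qed.

Lemma exp_flow0 x : exp_flow 0 x = x.
Proof.
apply: cvg_lim => //; rewrite -cvg_shiftS.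
apply: cvg_near_cst; apply: nearW => m /=.
rewrite seriesEnat /= big_nat_recl//= fact0 invr1 scale1r.
by rewrite big1 ?addr0// => k _; rewrite scale0r scaler0.
Qed.

Lemma is_derive_exp_flow h x t :
  is_derive t (1 : R) (fun s => h (exp_flow s x)) (h (L (exp_flow t x))).
Proof.
rewrite -[h (L _)]/((h \o L) _) exp_flowE -pseries_diffs_exp_coef.
under eq_fun do rewrite exp_flowE.
apply: (@pseries_snd_diffs _ _ (`|t| + 1)).
- exact: is_cvg_exp_coef.
- by rewrite pseries_diffs_exp_coef; exact: is_cvg_exp_coef.
- by rewrite !pseries_diffs_exp_coef; exact: is_cvg_exp_coef.
by rewrite [ltRHS]ger0_norm// addrC -subr_gt0 addrK.
Qed.

(** Each coordinate is differentiable in t, and a seminorm is continuous in the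
    coordinates. *)
Lemma continuous_exp_flow (q : X -> R) x : seminorm q ->
  continuous (fun t => q (exp_flow t x)).
Proof.
move=> sq t; have [cs csE] := choice (@ex_coord_linear R n).
have sqg : seminorm (q \o g).
  by split=> [y z|a y] /=; rewrite ?linearD ?linearZ; [exact: sq.1|exact: sq.2].
have ft : f (exp_flow s x) @[s --> t] --> f (exp_flow t x).
  apply: cvg_rV => j; under eq_fun do rewrite -csE.
  rewrite -csE; have [+ _] := is_derive_exp_flow (cs j \o f) x t.
  by move=> /derivable1_diffP /differentiable_continuous.
have qE : (fun s => q (exp_flow s x)) =
    (q \o g) \o (fun s => f (exp_flow s x)).
  by apply/funext => s /=; rewrite fK.
rewrite qE; apply: (continuous_cvg (nbhs_filter t) _ ft).
exact: seminorm_continuous.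
Qed.

End OperatorExponential.

(** * Order-unit spaces: gauge, states, oscillation and contraction rate *)

Section OrderUnit.
Context {R : realType} {X : normedModType R}.
Context (C : set X) (e : X).
Hypotheses (closedC : closed C) (coneC : convex_cone C) (pointedC : pointed C).
Hypotheses (inte : interior C e) (e0 : e != 0).
Implicit Types (x y : X) (a t : R) (mu nu : X -> R^o).

Lemma cone0 : C 0.
Proof.
by rewrite -(scale0r e); apply: coneC.2 => //; exact: interior_subset.
Qed.

Lemma coneD x y : C x -> C y -> C (x + y).
Proof.
move=> Cx Cy.
have h0 : 0 <= 2^-1 :> R by rewrite invr_ge0.
have h1 : 2^-1 <= 1 :> R by rewrite invf_le1// ler1n.
have /set_mem := coneC.1 x y (Itv01 h0 h1) (mem_set Cx) (mem_set Cy).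
move=> /(coneC.2 2 _ (ler0n _ _)); congr C.
rewrite -[LHS]/(2 *: (2^-1 *: x + (1 - 2^-1) *: y)) scalerDr !scalerA.
rewrite mulfV// scale1r.
by rewrite (_ : 2 * (1 - 2^-1) = 1 :> R) ?scale1r//; field.
Qed.

Lemma cone_antisym x : C x -> C (- x) -> x = 0.
Proof.
move=> Cx CNx; have : (C `&` [set - z | z in C]) x.
  by split=> //; exists (- x) => //; rewrite opprK.
by rewrite pointedC.
Qed.

(** A negative multiple of the unit in the cone would put both e and -e
    there. *)
Lemma cone_unitZ t : C (t *: e) -> 0 <= t.
Proof.
move=> Ct; rewrite leNgt; apply/negP => t0.
move/eqP: e0; apply; apply: cone_antisym; first exact: interior_subset.
have := coneC.2 (- t)^-1 _ _ Ct; rewrite invr_ge0 oppr_ge0 (ltW t0) => /(_ isT).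
by rewrite scalerA invrN mulNr mulVf ?lt_eqF// scaleN1r.
Qed.

(** A ball around e lies in the cone, so every vector is below a multiple of e
    proportional to its norm. *)
Lemma unit_absorbs : exists2 k : R, 0 < k & forall x, C ((k * `|x|) *: e - x).
Proof.
have /nbhs_ballP [r r0 hr] := inte.
(* the factor 2 keeps e - x / (k |x|) at distance r / 2 < r of e *)
exists (2 / r) => [|x]; first by rewrite divr_gt0.
have [->|x0] := eqVneq x 0.
  by rewrite normr0 mulr0 scale0r subr0; exact: cone0.
have nx : 0 < `|x| by rewrite normr_gt0.
have k0 : 0 < 2 / r * `|x| by rewrite mulr_gt0// divr_gt0.
have : C (e - (2 / r * `|x|)^-1 *: x).
  apply: hr; rewrite -ball_normE /ball_ /= subKr normrZ.
  rewrite normfV (gtr0_norm k0) invfM -mulrA mulVf ?gt_eqF// mulr1.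
  by rewrite invf_div gtr_pMr// invf_lt1// ltr1n.
move=> /(coneC.2 _ _ (ltW k0)); rewrite scalerBr scalerA mulfV ?gt_eqF//.
by rewrite scale1r.
Qed.

Definition order_gauge x : R := inf [set t | cone_le C x (t *: e)].

Lemma gauge_set_nonempty x : [set t | cone_le C x (t *: e)] !=set0.
Proof. by have [k _ hk] := unit_absorbs; exists (k * `|x|); exact: hk. Qed.

(** If x <= t e, then 0 <= (t + k |x|) e by absorbing - x. *)
Lemma gauge_set_lbound x : has_lbound [set t | cone_le C x (t *: e)].
Proof.
have [k _ hk] := unit_absorbs; exists (- (k * `|x|)) => t Ct.
have := coneD _ _ Ct (hk (- x)).
rewrite normrN opprK addrACA addNr addr0 -scalerDl.
by move=> /cone_unitZ; lra.
Qed.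

(** The infimum is attained because the cone is closed. *)
Lemma gauge_attained x : cone_le C x (order_gauge x *: e).
Proof.
set p := order_gauge x.
have ph : p + h @[h --> (0 : R)^'+] --> p.
  rewrite -[X in _ --> X]addr0; apply: cvgD; first exact: cvg_cst.
  exact: cvg_within.
have : (p + h) *: e - x @[h --> (0 : R)^'+] --> p *: e - x.
  by apply: cvgB; [exact: cvgZr_tmp|exact: cvg_cst].
apply: closed_cvg => //; near=> h.
have h0 : 0 < h by near: h; exact: nbhs_right_gt.
have [t Ct th] :=
  inf_adherent h0 (conj (gauge_set_nonempty x) (gauge_set_lbound x)).
have := coneD _ _ Ct (coneC.2 (p + h - t) e _ (interior_subset inte)).
rewrite subr_ge0 (ltW th) => /(_ isT).
by rewrite addrAC -scalerDl [t + _]addrC subrK.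
Unshelve. all: by end_near. Qed.

Lemma gauge_le x t : (order_gauge x <= t) <-> cone_le C x (t *: e).
Proof.
split=> [le_t|Ct]; last by apply: ge_inf => //; exact: gauge_set_lbound.
have := coneD _ _ (gauge_attained x)
  (coneC.2 (t - order_gauge x) e _ (interior_subset inte)).
rewrite subr_ge0 le_t => /(_ isT).
by rewrite addrAC -scalerDl [_ + (t - _)]addrC subrK.
Qed.

Lemma sublinear_gauge : sublinear order_gauge.
Proof.
split=> [x y|].
  apply/gauge_le; have := coneD _ _ (gauge_attained x) (gauge_attained y).
  by rewrite /cone_le addrACA -scalerDl opprD.
have hle a x : 0 <= a -> order_gauge (a *: x) <= a * order_gauge x.
  move=> a0; apply/gauge_le; rewrite /cone_le -scalerA -scalerBr.
  by apply: coneC.2 => //; exact: gauge_attained.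
move=> a x; rewrite le_eqVlt => /predU1P[<-|a0]; apply/eqP.
  rewrite eq_le hle//= scale0r mul0r.
  by apply: cone_unitZ; have := gauge_attained 0; rewrite /cone_le subr0.
rewrite eq_le (hle _ _ (ltW a0)) /=.
have := hle a^-1 (a *: x); rewrite invr_ge0 => /(_ (ltW a0)).
by rewrite scalerA mulVf ?gt_eqF// scale1r ler_pdivlMl.
Qed.

(** For a linear functional, domination by the gauge tested at - c with c in
    the cone gives positivity, tested at e and - e it gives normalisation, and
    tested at all x it gives continuity, the unit being interior. *)
Lemma cone_statesP mu :
  cone_states C e mu <-> linear mu /\ forall x, mu x <= order_gauge x.
Proof.
split=> [[[[lmu cmu] mu0] mue]|[lmu mug]].
  split=> // x; have [h hE] := linear_bundle mu lmu.
  have := mu0 _ (gauge_attained x); move: mue.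
  rewrite hE linearB linearZ => -> ge0.
  have : 0 <= order_gauge x * 1 - h x by [].
  by rewrite mulr1 subr_ge0.
have [h hE] := linear_bundle mu lmu.
have mupos x : C x -> 0 <= mu x.
  move=> Cx; rewrite -oppr_le0; have := mug (- x); rewrite hE linearN.
  move=> /le_trans; apply; apply/gauge_le.
  by rewrite /cone_le scale0r sub0r opprK.
split; last first.
  apply/eqP; rewrite eq_le; apply/andP; split.
    apply: le_trans (mug e) _; apply/gauge_le.
    by rewrite /cone_le scale1r subrr; exact: cone0.
  rewrite -lerN2; have := mug (- e); rewrite hE linearN => /le_trans; apply.
  by apply/gauge_le; rewrite /cone_le scaleN1r subrr; exact: cone0.
split=> //; split=> //.
have [k k0 hk] := unit_absorbs.
rewrite hE; apply/linear_bounded_continuous/linear_boundedP.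
have bnd x : h x <= k * `|x|.
  by rewrite -hE (le_trans (mug x))//; apply/gauge_le/hk.
near=> r => x; apply: (@le_trans _ _ (k * `|x|)).
  by rewrite ler_norml bnd andbT lerNl -linearN -(normrN x) bnd.
by rewrite ler_wpM2r//; near: r; exact: nbhs_pinfty_ge.
Unshelve. all: by end_near. Qed.

(** The supremum in Hopf's seminorm is minus the gauge of - x. *)
Definition oscillation x : R := order_gauge x + order_gauge (- x).

Lemma hopf_seminormE x : hopf_seminorm C e x = (oscillation x)%:E.
Proof.
rewrite /hopf_seminorm ereal_inf_EFin; last 2 first.
- exact: gauge_set_lbound.
- exact: gauge_set_nonempty.
rewrite ereal_supEN oppeK /oscillation EFinD; congr (_ + _)%E.
rewrite -ereal_inf_EFin; last 2 first.
- exact: gauge_set_lbound.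
- exact: gauge_set_nonempty.
congr ereal_inf; apply/seteqP; split=> [_ [_ [t Ct <-] <-]|_ [t Ct <-]].
  exists (- t) => //=; move: Ct.
  by rewrite /cone_le /= opprK scaleNr addrC.
exists ((- t)%:E); last by rewrite /= opprK.
by exists (- t) => //=; move: Ct; rewrite /cone_le scaleNr opprK /= opprK addrC.
Qed.

Lemma seminorm_oscillation : seminorm oscillation.
Proof.
have [gD gZ] := sublinear_gauge; split=> [x y|a x]; rewrite /oscillation.
  by have := gD x y; have := gD (- x) (- y); rewrite opprD; lra.
have [a0|/ltW a0] := leP 0 a.
  by rewrite -scalerN !gZ// ger0_norm// mulrDr.
have h0 : 0 <= - a by rewrite oppr_ge0.
have h z : order_gauge (a *: z) = - a * order_gauge (- z).
  by rewrite -gZ// scaleNr scalerN opprK.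
by rewrite -scalerN !h opprK ler0_norm// addrC mulrDr.
Qed.

(** The order-unit norm, in which the order segment lies in the unit ball. *)
Definition order_norm x : R := Num.max (order_gauge x) (order_gauge (- x)).

Lemma seminorm_order_norm : seminorm order_norm.
Proof.
have [gD gZ] := sublinear_gauge; split=> [x y|a x]; rewrite /order_norm.
  rewrite ge_max opprD !(le_trans (gD _ _))// lerD// le_max lexx ?orbT//.
have [a0|/ltW a0] := leP 0 a.
  by rewrite -scalerN !gZ// ger0_norm// maxr_pMr.
have h0 : 0 <= - a by rewrite oppr_ge0.
have h z : order_gauge (a *: z) = - a * order_gauge (- z).
  by rewrite -gZ// scaleNr scalerN opprK.
by rewrite -scalerN !h opprK ler0_norm// maxC maxr_pMr.
Qed.

Lemma order_norm_eq0 x : order_norm x = 0 -> x = 0.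
Proof.
move=> nx0; have : order_norm x <= 0 by rewrite nx0.
rewrite /order_norm ge_max => /andP[/gauge_le h1 /gauge_le h2].
apply: cone_antisym; first by move: h2; rewrite /cone_le scale0r sub0r opprK.
by move: h1; rewrite /cone_le scale0r sub0r.
Qed.

Context {n : nat} (f : {linear X -> 'rV[R]_n}) (g : {linear 'rV[R]_n -> X}).
Hypotheses (fK : cancel f g) (gK : cancel g f).

Lemma ex_extreme_state y :
  exists2 mu, extr (cone_states C e) mu & mu y = order_gauge y.
Proof.
have xE x : x = \sum_j f x 0 j *: g 'e_j.
  rewrite -{1}(fK x) {1}(row_sum_delta (f x)) linear_sum.
  by apply: eq_bigr => j _; rewrite linearZ.
have [mu [lmu mug muy muE]] := ex_extreme_support _ _ _ _ y xE sublinear_gauge.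
exists mu => //; split; first exact/cone_statesP.
move=> m1 m2 t /cone_statesP[l1 h1] /cone_statesP[l2 h2] t01 mut.
exact: muE mut.
Qed.

(** The segment is closed, and bounded because in finite dimension the
    order-unit norm dominates the norm of the coordinates. *)
Lemma compact_order_segment : compact [set v | order_segment C e (g v)].
Proof.
have gc := linear_continuous_rV g.
apply: bounded_closed_compact; last first.
  have -> : [set v | order_segment C e (g v)] =
      [set v | C (g v)] `&` [set v | C (e - g v)].
    by apply/seteqP; split=> v; rewrite /order_segment /cone_le /= subr0.
  apply: closedI.
    by apply: (closed_comp (f := g) (D := C)) => // v _; exact: gc.
  apply: (closed_comp (f := fun v => e - g v) (D := C)) => // v _.
  by apply: (@continuousB _ _ _ (cst e) g v); [exact: cst_continuous|exact: gc].
have sNg : seminorm (order_norm \o g).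
  have [nD nZ] := seminorm_order_norm.
  by split=> [y z|a y] /=; rewrite ?linearD ?linearZ; [exact: nD|exact: nZ].
have Ng0 v : (order_norm \o g) v = 0 -> v = 0.
  by move=> /order_norm_eq0 /(congr1 f); rewrite gK linear0.
have [M hM] := norm_le_seminorm _ sNg Ng0.
exists `|M|; split=> // r Mr v [Cv Cev]; apply: (le_trans _ (ltW Mr)).
rewrite (le_trans (hM v))//= -[leRHS]mulr1.
have N1 : order_norm (g v) <= 1.
  rewrite /order_norm ge_max; apply/andP; split; apply/gauge_le.
    by rewrite scale1r.
  rewrite /cone_le scale1r opprK; apply: coneD; first exact: interior_subset.
  by move: Cv; rewrite /cone_le subr0.
rewrite (le_trans (ler_wpM2r _ (ler_norm M)))//.
  exact: (seminorm_ge0 _ v sNg).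
exact: ler_wpM2l.
Qed.

(** Used with h = pi - nu and k the
    composite of h with L: the first maximisation cuts out the
    face on which pi = 1 and nu = 0, the second one finds an extreme point of
    the segment that is optimal on that face. *)
Lemma ex_extreme_segment (h k : {linear X -> R^o}) :
  exists x, [/\ extr (order_segment C e) x,
    forall y, order_segment C e y -> h y <= h x &
    forall y, order_segment C e y -> h y = h x -> k y <= k x].
Proof.
have K0 : [set v | order_segment C e (g v)] !=set0.
  exists 0; rewrite /= linear0; split; rewrite /cone_le subr0.
    exact: cone0.
  exact: interior_subset.
have [v [[Kv vext] hmax kmax]] :=
  ex_extreme_lexmax _ (h \o g) (k \o g) compact_order_segment K0.
exists (g v); split.
- split=> // y z t Ky Kz t01 gE.
  have Kfy : order_segment C e (g (f y)) by rewrite fK.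
  have Kfz : order_segment C e (g (f z)) by rewrite fK.
  have vE : v = t *: f y + (1 - t) *: f z by rewrite -[v]gK gE linearD !linearZ.
  have [ey ez] := vext (f y) (f z) t Kfy Kfz t01 vE.
  by split; [rewrite -ey fK|rewrite -ez fK].
- by move=> y Ky; have := hmax (f y); rewrite /= fK; exact.
- by move=> y Ky; have := kmax (f y); rewrite /= fK => /(_ Ky).
Qed.

Context (L : {linear X -> X}) (Le : L e = 0).

Lemma state_segment mu x : cone_states C e mu -> order_segment C e x ->
  0 <= mu x <= 1.
Proof.
move=> [[[lmu _] mu0] mue] [Cx Cex]; have [h hE] := linear_bundle mu lmu.
rewrite mu0 ?andTb; last by move: Cx; rewrite /cone_le subr0.
by have := mu0 _ Cex; rewrite -mue hE linearB subr_ge0.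
Qed.

(** The two pairings in the infimum are complementary because L e = 0. *)
Lemma pairing_complement nu pi x : linear pi ->
  nu (L x) + pi (L (e - x)) = - (pi (L x) - nu (L x)).
Proof.
move=> /linear_bundle[h ->].
by rewrite linearB Le sub0r linearN opprB.
Qed.

(** Both terms of the sum are nonnegative on the segment. *)
Lemma face_condition nu pi x : cone_states C e nu -> cone_states C e pi ->
  order_segment C e x ->
  nu x + pi (e - x) = 0 <-> nu x = 0 /\ pi x = 1.
Proof.
move=> snu spi sx; have /andP[nu0 _] := state_segment _ _ snu sx.
have /andP[_ pi1] := state_segment _ _ spi sx.
have [[[lpi _] _] pie] := spi; have [h hE] := linear_bundle pi lpi.
rewrite hE linearB -hE pie; split=> [h0|[-> ->]]; last by rewrite add0r subrr.
by split; lra.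
Qed.

(** If the bound holds at the extreme points of the order segment, it holds at
    every y and every pair of states extremal at y: after an affine
    normalisation y lies in a face of the segment, over which a linear
    functional is maximal at an extreme point. *)
Lemma extremal_pair_le a nu pi y :
  (forall x, extr (order_segment C e) x -> nu x = 0 -> pi x = 1 ->
    pi (L x) - nu (L x) <= a) ->
  cone_states C e nu -> cone_states C e pi ->
  pi y = order_gauge y -> nu y = - order_gauge (- y) ->
  pi (L y) - nu (L y) <= a * oscillation y.
Proof.
move=> bound snu spi piy nuy.
have [[[lpi _] _] pie] := spi; have [[[lnu _] _] nue] := snu.
have [p pE] := linear_bundle pi lpi; have [q qE] := linear_bundle nu lnu.
have gy1 : C (order_gauge y *: e - y) by apply: gauge_attained.
have gy2 : C (y + order_gauge (- y) *: e).
  by have := gauge_attained (- y); rewrite /cone_le opprK addrC.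
have oscE : oscillation y = pi y - nu y by rewrite piy nuy opprK.
have : 0 <= oscillation y by apply: seminorm_ge0; exact: seminorm_oscillation.
rewrite le_eqVlt => /predU1P[osc0|osc_gt0].
  (* oscillation zero: y is a multiple of the unit, which L kills *)
  have gN : order_gauge (- y) = - order_gauge y.
    by move: osc0; rewrite oscE piy nuy => ?; lra.
  have yE : order_gauge y *: e - y = 0.
    by apply: cone_antisym => //; rewrite opprB -scaleNr -gN.
  move/eqP: yE; rewrite subr_eq0 => /eqP yE.
  have Ly : L y = 0 by rewrite -yE linearZ /= Le scaler0.
  by rewrite -osc0 mulr0 Ly pE qE !linear0 addr0.
(* z is y rescaled to have minimum 0 under nu and maximum 1 under pi *)
pose z := (oscillation y)^-1 *: (y - nu y *: e).
have on0 : oscillation y != 0 by rewrite gt_eqF.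
have yE : y = oscillation y *: z + nu y *: e.
  by rewrite /z scalerA mulfV// scale1r subrK.
have sz : order_segment C e z.
  split; rewrite /cone_le.
    rewrite subr0; apply: coneC.2; first by rewrite invr_ge0 ltW.
    by rewrite nuy scaleNr opprK.
  have -> : e - z = (oscillation y)^-1 *: (order_gauge y *: e - y).
    apply: (scalerI on0); rewrite scalerBr /z !scalerA mulfV// !scale1r.
    by rewrite oscE piy scalerBl opprB addrA subrK.
  by apply: coneC.2 => //; rewrite invr_ge0 ltW.
have zval (h : {linear X -> R^o}) :
    h z = (oscillation y)^-1 * (h y - nu y * h e).
  by rewrite /z linearZ linearB linearZ.
have nuz : nu z = 0.
  by rewrite {1}qE zval -qE nue mulr1 subrr mulr0.
have piz : pi z = 1.
  by rewrite pE zval -pE pie mulr1 -oscE mulVf.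
clearbody z.
have [x [xext xmax xmax2]] := ex_extreme_segment (p \- q) ((p \- q) \o L).
have /andP[nx0 _] := state_segment _ _ snu xext.1.
have /andP[_ px1] := state_segment _ _ spi xext.1.
move: xmax xmax2 => /(_ z sz) /= + /(_ z sz) /=.
rewrite -!pE -!qE nuz piz subr0 => px_qx.
(* 1 is the largest value of pi - nu on the segment, and z attains it *)
have nux : nu x = 0 by lra.
have pix : pi x = 1 by lra.
rewrite nux pix subr0 => /(_ erefl) Lz_le_Lx.
have := le_trans Lz_le_Lx (bound x xext nux pix).
rewrite -(ler_pM2l osc_gt0) => /(le_trans _); rewrite [leRHS]mulrC; apply.
have -> : L y = oscillation y *: L z.
  by rewrite {1}yE linearD !linearZ /= Le scaler0 addr0.
have scale_out (h : {linear X -> R^o}) :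
    h (oscillation y *: L z) = oscillation y * h (L z).
  by rewrite linearZ.
by rewrite pE qE !scale_out mulrBr.
Qed.

(** Sufficiency: the bound at the extreme data makes the oscillation along the
    flow satisfy a differential inequality, since at each time it is touched
    from below by the difference of two extreme states. *)
Lemma oscillation_decay a x t :
  (forall nu pi z, extr (cone_states C e) nu -> extr (cone_states C e) pi ->
    extr (order_segment C e) z -> nu z = 0 -> pi z = 1 ->
    pi (L z) - nu (L z) <= a) ->
  0 <= t -> oscillation (exp_flow L t x) <= expR (a * t) * oscillation x.
Proof.
move=> bound t0.
rewrite -{2}(exp_flow0 L x).
apply: (gronwall_touching (fun s => oscillation (exp_flow L s x))) => //.
  exact: (continuous_exp_flow f g fK L _ x seminorm_oscillation).
move=> c _; pose y := exp_flow L c x.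
have [pi pext piy] := ex_extreme_state y.
have [nu next nuy] := ex_extreme_state (- y).
have [lpi pig] := (cone_statesP pi).1 pext.1.
have [lnu nug] := (cone_statesP nu).1 next.1.
have [p pE] := linear_bundle pi lpi; have [q qE] := linear_bundle nu lnu.
have nuN z : nu (- z) = - nu z by rewrite qE linearN.
exists (fun s => (p \- q) (exp_flow L s x)), ((p \- q) (L y)); split.
- exact: (is_derive_exp_flow f g fK).
- by rewrite /= -pE -qE piy /oscillation -nuy nuN.
- move=> s; rewrite /= -pE -qE /oscillation lerD//.
  by rewrite -nuN.
- rewrite /= -pE -qE; apply: extremal_pair_le => //.
  + by move=> z zext; exact: bound.
  + exact: next.1.
  + exact: pext.1.
  + by rewrite -nuy nuN opprK.
Qed.

(** Necessity: the decay bound is an equality at time 0 for the chosen data, so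
    it may be differentiated there. *)
Lemma decay_extremal_bound a nu pi x :
  (forall t, 0 <= t ->
    oscillation (exp_flow L t x) <= expR (a * t) * oscillation x) ->
  cone_states C e nu -> cone_states C e pi -> order_segment C e x ->
  nu x = 0 -> pi x = 1 -> pi (L x) - nu (L x) <= a.
Proof.
move=> decay snu spi [Cx Cex] nux pix.
have [lpi pig] := (cone_statesP pi).1 spi.
have [lnu nug] := (cone_statesP nu).1 snu.
have [p pE] := linear_bundle pi lpi; have [q qE] := linear_bundle nu lnu.
(* in fact pi - nu witnesses equality, which makes the comparison sharp at 0 *)
have osc1 : oscillation x <= 1.
  have h1 : order_gauge x <= 1 by apply/gauge_le; rewrite scale1r.
  have h2 : order_gauge (- x) <= 0.
    by apply/gauge_le; move: Cx; rewrite /cone_le scale0r opprK subr0 add0r.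
  by rewrite /oscillation; lra.
pose D s : R := expR (a * s) - (p \- q) (exp_flow L s x).
have dD : is_derive (0 : R) (1 : R) D (a - (p \- q) (L x)).
  have dflow := is_derive_exp_flow f g fK L (p \- q) x 0.
  rewrite exp_flow0 in dflow.
  apply: is_derive_eq.
  by rewrite mulr0 expR0 mul1r [a%:A]mulr1.
have D0 : D 0 = 0.
  by rewrite /D exp_flow0 mulr0 expR0 /= -pE -qE pix nux subr0 subrr.
rewrite pE qE -subr_ge0.
apply: (is_derive_ge0 _ _ _ _ dD at_right_dnbhs0).
near=> h.
have h0 : 0 < h by near: h; exact: nbhs_right_gt.
rewrite D0 subr0 add0r; apply: mulr_ge0; first by rewrite invr_ge0 ltW.
rewrite /D subr_ge0 /= -pE -qE.
have := decay h (ltW h0).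
have := ler_wpM2l (expR_ge0 (a * h)) osc1; rewrite mulr1.
have := pig (exp_flow L h x); have := nug (- exp_flow L h x).
rewrite {1}qE linearN -qE /oscillation => h1 h2 h3 h4.
by lra.
Unshelve. all: by end_near. Qed.

End OrderUnit.

(** * The optimal rate *)

(** When 0 is interior, the cone is the whole space, and being pointed it is
    the zero space. There the oscillation is -oo and no state is normalised, so
    that both sides of the equality are -oo. *)
Lemma zero_unit_rate {R : realType} {X : normedModType R} (C : set X)
    (L : X -> X) : convex_cone C -> pointed C -> interior C 0 ->
  optimal_rate C 0 L = contraction_formula C 0 L.
Proof.
move=> coneC pointedC int0.
have [k _ hk] := unit_absorbs C 0 coneC int0.
have Call x : C x by have := hk (- x); rewrite scaler0 sub0r opprK.
have hopf0 x : hopf_seminorm C 0 x = -oo%E.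
  rewrite /hopf_seminorm (_ : ereal_inf _ = -oo%E) ?addNye//.
  apply: eq_ninfty => t; apply: ereal_inf_lbound.
  by exists t => //; exact: Call.
have nostate mu : ~ cone_states C 0 mu.
  move=> [[[lmu _] _]]; have [h ->] := linear_bundle mu lmu.
  by rewrite linear0 => /esym/eqP; rewrite oner_eq0.
transitivity (-oo : \bar R)%E.
  apply: eq_ninfty => t; apply: ereal_inf_lbound; exists t => // s x s0.
  by rewrite !hopf0 leNye.
rewrite /contraction_formula (_ : _ `*` _ = set0).
  by rewrite image_set0 ereal_inf0.
by apply/seteqP; split=> // -[nu pi] [[/nostate]].
Qed.

Theorem proposition5p1 (R : realType) (X : normedModType R)
  (n : nat) (dimX : Vector.axiom n X)
  (C : set X) (closedC : closed C) (coneC : convex_cone C)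
  (pointedC : pointed C) (intC : interior C !=set0)
  (e : X) (inte : interior C e)
  (L : {linear X -> X}) (Le : L e = 0) :
  optimal_rate C e L = contraction_formula C e L.
Proof.
have [e0|e0] := eqVneq e 0.
  by move: inte; rewrite e0; exact: zero_unit_rate.
have [f [g [fK gK]]] := vector_axiom_coordinates dimX.
have hopfE := hopf_seminormE C e coneC pointedC inte e0.
have decayP (a t : R) (x : X) :
    (hopf_seminorm C e (exp_op (fun y => t *: L y) x)
      <= (expR (a * t))%:E * hopf_seminorm C e x)%E =
    (oscillation C e (exp_flow L t x) <= expR (a * t) * oscillation C e x).
  by rewrite !hopfE -EFinM lee_fin.
have pairingE nu pi x : extr (cone_states C e) pi ->
    nu (L x) + pi (L (e - x)) = - (pi (L x) - nu (L x)).
  by move=> [[[[lpi _] _] _] _]; exact: pairing_complement.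
apply/eqP; rewrite eq_le; apply/andP; split; last first.
  apply: le_ereal_inf_tmp => _ [a decay <-].
  rewrite /contraction_formula leeNl.
  apply: le_ereal_inf_tmp => _ [[nu pi] [/= nu_ext pi_ext] <-].
  apply: le_ereal_inf_tmp => _ [x [x_ext xface] <-].
  have [nux pix] :=
    (face_condition C e nu pi x nu_ext.1 pi_ext.1 x_ext.1).1 xface.
  rewrite lee_fin pairingE// lerN2.
  apply: (decay_extremal_bound C e closedC coneC pointedC inte e0 f g fK L a)
    nu_ext.1 pi_ext.1 x_ext.1 nux pix => t t0.
  by rewrite -decayP; exact: decay.
have admissible a : (contraction_formula C e L <= a%:E)%E ->
    (optimal_rate C e L <= a%:E)%E.
  move=> ha; apply: ereal_inf_lbound; exists a => // t x t0.
  rewrite decayP.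
  apply: (oscillation_decay C e closedC coneC pointedC inte e0 f g fK gK L Le)
    => //.
  move=> nu pi z nu_ext pi_ext z_ext nuz piz.
  rewrite -lee_fin; apply: le_trans ha.
  rewrite /contraction_formula leeNr -EFinN -(pairingE nu)//.
  apply: le_trans (ereal_inf_lbound _) _; first by exists (nu, pi).
  apply: ereal_inf_lbound; exists z => //=; split=> //.
  exact/(face_condition C e nu pi z nu_ext.1 pi_ext.1 z_ext.1).
case hE : (contraction_formula C e L) => [r| |].
- by apply: admissible; rewrite hE.
- by rewrite leey.
- rewrite leeNy_eq; apply/eqP/eq_ninfty => t.
  by apply: admissible; rewrite hE leNye.
Qed.
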